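(* In the setting described in the context, assume that $D^pf$ is Lipschitz continuous (with respect to $\|\cdot\|_2$ on tensors), that $x_k\to x_*\in\mathbb{R}^n$ and $W_k\to W_*$ for some nonsingular $W_*\in\mathbb{R}^{n\times n}$, with $\sum_{k\ge0}\|x_k-x_*\|_2<\infty$ and $\sum_{k\ge0}\|W_k-W_*\|_2<\infty$. Then $\lim_{k\to\infty}\frac{\|(\mathcal{C}_k-D^pf(x_* ))[s_k]\|_F}{\|s_k\|_2}=0$.
   Context: Setting (higher-order secant update): $p\ge 2$; $f:\mathbb{R}^n\to\mathbb{R}$ is $p$ times continuously differentiable, $D^pf(x)$ denoting its $p$th derivative viewed as a symmetric multilinear map; $(x_k)_{k\ge0}$ is a sequence in $\mathbb{R}^n$ with steps $s_k = x_{k+1}-x_k \ne 0$; $(W_k)_{k\ge0}$ are nonsingular $n\times n$ matrices; $\widetilde{\mathcal{C}}_k = \int_0^1 D^pf(x_k+ts_k)\,dt$; $\mathcal{C}_0\in\mathbb{R}^{\otimes^p n}_{\mathrm{sym}}$ is arbitrary and $\mathcal{C}_{k+1}$ is the unique minimizer of $\|(\mathcal{C}-\mathcal{C}_k)[W_k]^p\|_F$ over $\mathcal{C}\in\mathbb{R}^{\otimes^p n}_{\mathrm{sym}}$ subject to $\mathcal{C}[s_k]=\widetilde{\mathcal{C}}_k[s_k]$. Notation: a $p$-tensor is a multilinear map $(\mathbb{R}^n)^p\to\mathbb{R}$; $\mathcal{T}[s]$ fixes the first argument to $s$ (a $(p-1)$-tensor); $(\mathcal{T}[M]^p)[s_1,\dots,s_p]=\mathcal{T}[Ms_1,\dots,Ms_p]$;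 symmetric means invariant under permutation of arguments; $\|\cdot\|_F$ is the Frobenius norm of the array of entries; $\|\mathcal{T}\|_2=\max_{\|u_i\|_2=1}|\mathcal{T}[u_1,\dots,u_p]|$; on matrices $\|\cdot\|_2$ is the spectral norm. *)

(* Defs.v *)
From HB Require Import structures.
From mathcomp Require Import all_boot all_order all_algebra.
From mathcomp Require Import all_classical all_reals all_analysis.
Set Implicit Arguments. Unset Strict Implicit. Unset Printing Implicit Defensive.
Import Order.TTheory GRing.Theory Num.Theory.
Import numFieldNormedType.Exports.
Local Open Scope classical_set_scope.
Local Open Scope ring_scope.

Section Defs.
Variables (R : realType) (n : nat).

Definition vnorm2 (v : 'cV[R]_n) : R := Num.sqrt (\sum_(i < n) v i 0 ^+ 2).

Definition evec (i : 'I_n) : 'cV[R]_n := delta_mx i 0.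

Definition mnorm2 (M : 'M[R]_n) : R :=
  sup [set vnorm2 (M *m v) | v in [set v | vnorm2 v = 1]].

(* A tensor (of an order fixed by context) is given by its array of entries,
   indexed by sequences of indices; a p-tensor is only ever read at index
   sequences of length p. *)
Definition tensor := seq 'I_n -> R.

Definition tsub (T U : tensor) : tensor := fun l => T l - U l.

Definition teval (T : tensor) (us : seq 'cV[R]_n) : R :=
  \sum_(t : (size us).-tuple 'I_n)
     T t * \prod_(k < size us) (nth 0 us k) (tnth t k) 0.

Definition tfix (T : tensor) (s : 'cV[R]_n) : tensor :=
  fun l => \sum_(i < n) s i 0 * T (i :: l).

Definition tchange (T : tensor) (M : 'M[R]_n) : tensor :=
  fun l => teval T [seq M *m evec j | j <- l].

Definition frob (p : nat) (T : tensor) : R :=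
  Num.sqrt (\sum_(t : p.-tuple 'I_n) T t ^+ 2).

Definition tnorm2 (p : nat) (T : tensor) : R :=
  sup [set `|teval T (tval u)| |
        u in [set u : p.-tuple 'cV[R]_n | forall k, vnorm2 (tnth u k) = 1]].

Definition tsym (p : nat) (T : tensor) : Prop :=
  forall t t' : p.-tuple 'I_n, perm_eq t t' -> T t = T t'.

Definition iterpartial (l : seq 'I_n) (g : 'cV[R]_n -> R) : 'cV[R]_n -> R :=
  foldr (fun i h => fun x => derive h x (evec i)) g l.

Definition Cp (p : nat) (f : 'cV[R]_n -> R) : Prop :=
  (forall l : seq 'I_n, (size l < p)%N ->
      forall (i : 'I_n) (x : 'cV[R]_n), derivable (iterpartial l f) x (evec i))
  /\ (forall l : seq 'I_n, (size l <= p)%N -> continuous (iterpartial l f)).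

Definition Dtensor (f : 'cV[R]_n -> R) (x : 'cV[R]_n) : tensor :=
  fun l => iterpartial l f x.

Definition avgD (f : 'cV[R]_n -> R) (x s : 'cV[R]_n) : tensor :=
  fun l => Rintegral (@lebesgue_measure R) `[0%R, 1%R]
             (fun t : R => Dtensor f (x + t *: s) l).

Definition secant_min (p : nat) (Cprev W : _) (s : 'cV[R]_n) (Ct C : tensor) : Prop :=
  tsym p C /\ (forall t : p.-1.-tuple 'I_n, tfix C s t = tfix Ct s t) /\
  forall C' : tensor, tsym p C' ->
    (forall t : p.-1.-tuple 'I_n, tfix C' s t = tfix Ct s t) ->
    frob p (tchange (tsub C Cprev) W) <= frob p (tchange (tsub C' Cprev) W).

End Defs.

(* Main.v *)
(* With D := D^p f(xs), T_k the averaged derivative and |.|_W the Frobenius norm of E[W]^p, the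
   update is an orthogonal projection for |.|_{W_k}, so, T_k being symmetric (Clairaut),
     |T_k - C_k|^2 = |C_{k+1} - C_k|^2 + |T_k - C_{k+1}|^2.
   The Lipschitz bound makes T_k - D summable, and |.|_{W_k} agrees with |.|_{Ws} up to a factor
   1 + O(|W_k - Ws|).  Hence |C_k - D|_{Ws} decreases up to summable errors, so it converges, and
   the identity forces |C_{k+1} - C_k| -> 0.  The secant equation gives
   (T_k - C_k)[s_k] = (C_{k+1} - C_k)[s_k] = o(|s_k|), and T_k -> D concludes. *)
Require Import Defs.
From HB Require Import structures.
From mathcomp Require Import all_boot all_order all_algebra.
From mathcomp Require Import all_classical all_reals all_analysis.
From mathcomp Require Import ring lra.
Import Order.TTheory GRing.Theory Num.Theory.
Import numFieldNormedType.Exports.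
Local Open Scope classical_set_scope.
Local Open Scope ring_scope.

Set Implicit Arguments. Unset Strict Implicit. Unset Printing Implicit Defensive.

(** * Euclidean norm of finite families; entrywise bounds for linear maps and products *)

Section EuclideanNorm.
Variables (R : realType) (I : finType).
Implicit Types u v : I -> R.

Definition l2norm u : R := Num.sqrt (\sum_i u i ^+ 2).

Lemma sum_sqr_ge0 u : 0 <= \sum_i u i ^+ 2.
Proof. by apply: sumr_ge0 => i _; exact: sqr_ge0. Qed.

Lemma l2norm_ge0 u : 0 <= l2norm u.
Proof. exact: sqrtr_ge0. Qed.

Lemma sqr_l2norm u : l2norm u ^+ 2 = \sum_i u i ^+ 2.
Proof. by rewrite sqr_sqrtr// sum_sqr_ge0. Qed.

Lemma ler_l2norm u i : `|u i| <= l2norm u.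
Proof.
rewrite -sqrtr_sqr ler_wsqrtr// (bigD1 i)//= lerDl.
by apply: sumr_ge0 => j _; exact: sqr_ge0.
Qed.

Lemma eq_l2norm u v : u =1 v -> l2norm u = l2norm v.
Proof. by move=> uv; congr Num.sqrt; apply: eq_bigr => i _; rewrite uv. Qed.

Lemma eq_l2norm_le u v : u =1 v -> l2norm u <= l2norm v.
Proof. by move=> /eq_l2norm ->. Qed.

Lemma l2norm_gt0 u i : u i != 0 -> 0 < l2norm u.
Proof. by move=> ui; apply: lt_le_trans (ler_l2norm u i); rewrite normr_gt0. Qed.

Lemma l2normN u : l2norm (fun i => - u i) = l2norm u.
Proof. by congr Num.sqrt; apply: eq_bigr => i _; rewrite sqrrN. Qed.

Lemma sum_sqr_lincomb a b u v : \sum_i (a * u i + b * v i) ^+ 2 =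
  a ^+ 2 * (\sum_i u i ^+ 2) + (2 * a * b) * (\sum_i u i * v i)
  + b ^+ 2 * (\sum_i v i ^+ 2).
Proof. rewrite !mulr_sumr -!big_split/=; apply: eq_bigr => i _; ring. Qed.

(** The squared norm of [B u - P v] equals [B (A B - P^2)]; it is nonnegative, and [B > 0] unless
    [v] vanishes. *)
Lemma cauchy_schwarz u v : \sum_i u i * v i <= l2norm u * l2norm v.
Proof.
set A := \sum_i u i ^+ 2; set B := \sum_i v i ^+ 2; set P := \sum_i _.
have [v0|/forallPn[i0 vi0]] := boolP [forall i, v i == 0].
  rewrite [P]big1 ?mulr_ge0 ?l2norm_ge0// => i _.
  by rewrite (eqP (forallP v0 i)) mulr0.
have B0 : 0 < B by rewrite -[B](sqr_l2norm v) exprn_gt0// (@l2norm_gt0 _ i0).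
have : 0 <= B * (A * B - P ^+ 2).
  have := sum_sqr_ge0 (fun i => B * u i + - P * v i).
  by rewrite sum_sqr_lincomb -/A -/B -/P; congr (0 <= _); ring.
rewrite pmulr_rge0// subr_ge0 => PAB.
apply: le_trans (ler_norm _) _.
rewrite -(@ler_pXn2r _ 2) ?nnegrE ?mulr_ge0 ?l2norm_ge0//.
by rewrite exprMn !sqr_l2norm real_normK ?num_real.
Qed.

Lemma ler_l2normD u v : l2norm (fun i => u i + v i) <= l2norm u + l2norm v.
Proof.
rewrite -(@ler_pXn2r _ 2) ?nnegrE ?addr_ge0 ?l2norm_ge0//.
rewrite sqr_l2norm sqrrD !sqr_l2norm.
have -> : \sum_i (u i + v i) ^+ 2 = \sum_i (1 * u i + 1 * v i) ^+ 2.
  by apply: eq_bigr => i _; rewrite !mul1r.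
rewrite sum_sqr_lincomb; have := cauchy_schwarz u v; lra.
Qed.

Lemma ler_l2norm_sum u : l2norm u <= \sum_i `|u i|.
Proof.
rewrite -(@ler_pXn2r _ 2) ?nnegrE ?l2norm_ge0 ?sumr_ge0//.
rewrite sqr_l2norm expr2 mulr_suml; apply: ler_sum => i _.
rewrite -real_normK ?num_real// expr2 ler_wpM2l// (bigD1 i)//= lerDl.
exact: sumr_ge0.
Qed.

Lemma ler_l2norm_const u M : (forall i, `|u i| <= M) -> l2norm u <= #|I|%:R * M.
Proof.
move=> uM; apply: le_trans (ler_l2norm_sum _) _.
apply: (@le_trans _ _ (\sum_(i : I) M)); first exact: ler_sum.
by rewrite sumr_const mulr_natl.
Qed.

(** Minimality at [tau = 0] gives [2 tau P + tau^2 B >= 0] for every [tau], which forces the inner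
    product [P] of [X] and [Y] to vanish. *)
Lemma l2norm_min_pythagoras (X Y : I -> R) :
  (forall tau : R, l2norm X <= l2norm (fun i => X i + tau * Y i)) ->
  l2norm (fun i => X i + Y i) ^+ 2 = l2norm X ^+ 2 + l2norm Y ^+ 2.
Proof.
move=> minX; set P := \sum_i X i * Y i; set B := \sum_i Y i ^+ 2.
have expand tau : \sum_i (X i + tau * Y i) ^+ 2
    = \sum_i X i ^+ 2 + (2 * tau) * P + tau ^+ 2 * B.
  transitivity (\sum_i (1 * X i + tau * Y i) ^+ 2).
    by apply: eq_bigr => i _; rewrite mul1r.
  by rewrite sum_sqr_lincomb expr1n mul1r mulr1.
have quad tau : 0 <= 2 * tau * P + tau ^+ 2 * B.
  have := minX tau; rewrite -(@ler_pXn2r _ 2) ?nnegrE ?l2norm_ge0//.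
  rewrite !sqr_l2norm expand; lra.
suff P0 : P = 0.
  have := expand 1; rewrite P0 mulr0 addr0 expr1n mul1r !sqr_l2norm => <-.
  by apply: eq_bigr => i _; rewrite mul1r.
have B1 : 0 < B + 1 by rewrite ltr_wpDl// sum_sqr_ge0.
(* The vertex of the parabola is at [- P / B]; the denominator [B + 1] covers [B = 0] as well and
   still makes the value negative when [P] is nonzero. *)
have := quad (- (P / (B + 1))).
have -> : 2 * - (P / (B + 1)) * P + (- (P / (B + 1))) ^+ 2 * B
    = - ((P / (B + 1)) ^+ 2 * (B + 2)).
  field; exact: lt0r_neq0.
have B2 : 0 < B + 2 by lra.
rewrite oppr_ge0 pmulr_lle0// => PB.
have : (P / (B + 1)) ^+ 2 = 0 by apply/eqP; rewrite eq_le PB sqr_ge0.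
by move/eqP; rewrite sqrf_eq0 mulf_eq0 invr_eq0 (gt_eqF B1) orbF => /eqP.
Qed.

End EuclideanNorm.

(** The constant is crude but linear in the bound [c] on the entries, so a small matrix gives a
    small operator; perturbation estimates rely on this. *)
Lemma ler_l2norm_linear (R : realType) (I J : finType) (A : I -> J -> R)
    (c : R) (u : J -> R) : (forall i j, `|A i j| <= c) ->
  l2norm (fun i => \sum_j u j * A i j) <= #|I|%:R * (#|J|%:R * c) * l2norm u.
Proof.
move=> Ac; rewrite -mulrA; apply: ler_l2norm_const => i.
apply: le_trans (ler_norm_sum _ _ _) _.
apply: (@le_trans _ _ (\sum_(j : J) l2norm u * c)).
  by apply: ler_sum => j _; rewrite normrM ler_pM// ler_l2norm.
by rewrite sumr_const -[_ *+ _]mulr_natl mulrA mulrAC.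
Qed.

Lemma l2norm_linear_bound (R : realType) (I J : finType) (A : I -> J -> R) :
  exists2 K, 0 <= K &
    forall u : J -> R, l2norm (fun i => \sum_j u j * A i j) <= K * l2norm u.
Proof.
pose c := \sum_i \sum_j `|A i j|.
have c0 : 0 <= c by apply: sumr_ge0 => i _; exact: sumr_ge0.
have Ac i j : `|A i j| <= c.
  rewrite /c (bigD1 i)//= (bigD1 j)//= -addrA lerDl addr_ge0// ?sumr_ge0// => k _.
  exact: sumr_ge0.
exists (#|I|%:R * (#|J|%:R * c)); first by rewrite !mulr_ge0.
by move=> u; exact: ler_l2norm_linear.
Qed.

(** Telescoping: one factor is exchanged at a time, at a cost of [e] times the remaining factors.
    The assumption [1 <= c] allows the same power [c ^+ p] for every term. *)
Lemma ler_norm_prodB (R : realType) (p : nat) (a b : 'I_p -> R) (c e : R) :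
  1 <= c -> (forall k, `|a k| <= c) -> (forall k, `|b k| <= c) ->
  (forall k, `|a k - b k| <= e) ->
  `|\prod_k a k - \prod_k b k| <= p%:R * c ^+ p * e.
Proof.
move=> c1; have c0 : 0 <= c by rewrite (le_trans _ c1).
elim: p a b => [|p IH] a b ac bc abe.
  by rewrite !big_ord0 subrr normr0 !mul0r.
have e0 : 0 <= e by rewrite (le_trans _ (abe ord0)).
rewrite !big_ord_recl; set P := \prod_(_ < p) a _; set Q := \prod_(_ < p) b _.
have PQ : `|P - Q| <= p%:R * c ^+ p * e by apply: IH => k.
have Pc : `|P| <= c ^+ p.
  rewrite normr_prod -[leRHS]mulr1 -[X in _ * X](expr1n _ p) -exprMn mulr1.
  rewrite -[p in leRHS]card_ord -prodr_const.
  by apply: ler_prod => k _; rewrite normr_ge0 ac.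
have -> : a ord0 * P - b ord0 * Q = (a ord0 - b ord0) * P + b ord0 * (P - Q) by ring.
apply: le_trans (ler_normD _ _) _; rewrite !normrM.
apply: (@le_trans _ _ (e * c ^+ p + c * (p%:R * c ^+ p * e))).
  by apply: lerD; apply: ler_pM.
have -> : p.+1%:R * c ^+ p.+1 * e = e * c ^+ p * c + c * (p%:R * c ^+ p * e).
  by rewrite -natr1 exprS; ring.
by rewrite lerD2r ler_peMr// mulr_ge0// exprn_ge0.
Qed.

(** * Tensor norms and change of variables *)

Section Tensors.
Variables (R : realType) (n : nat).
Implicit Types (T U : tensor R n) (M : 'M[R]_n) (v : 'cV[R]_n).

Lemma vnorm2E v : vnorm2 v = l2norm (fun i => v i 0).
Proof. by []. Qed.

Lemma ler_vnorm2 v i : `|v i 0| <= vnorm2 v.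
Proof. exact: (ler_l2norm (fun i => v i 0)). Qed.

Lemma vnorm2_ge0 v : 0 <= vnorm2 v.
Proof. exact: sqrtr_ge0. Qed.

Lemma vnorm2_gt0 v : v != 0 -> 0 < vnorm2 v.
Proof.
move=> v0; have [i vi] : exists i, v i 0 != 0.
  apply/existsP; apply: contraNT v0; rewrite negb_exists => /forallP v0.
  apply/eqP/matrixP => i j; rewrite (ord1 j) mxE.
  by apply/eqP; rewrite -[_ == _]negbK v0.
exact: (@l2norm_gt0 _ _ (fun i => v i 0) i).
Qed.

Lemma vnorm2D v w : vnorm2 (v + w) <= vnorm2 v + vnorm2 w.
Proof.
rewrite !vnorm2E; apply: le_trans (ler_l2normD _ _).
by rewrite (@eq_l2norm _ _ _ (fun i => v i 0 + w i 0))// => i; rewrite mxE.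
Qed.

Lemma vnorm2Z (a : R) v : vnorm2 (a *: v) = `|a| * vnorm2 v.
Proof.
rewrite /vnorm2 -sqrtr_sqr -sqrtrM ?sqr_ge0// mulr_sumr.
by congr Num.sqrt; apply: eq_bigr => i _; rewrite mxE exprMn.
Qed.

Lemma vnorm2_evec (i : 'I_n) : vnorm2 (evec R i) = 1.
Proof.
rewrite /vnorm2 (bigD1 i)//= big1 => [|j ji]; rewrite /evec mxE ?eqxx ?andbT.
  by rewrite expr1n addr0 sqrtr1.
by rewrite (negPf ji) expr0n.
Qed.

Lemma mul_evec M i j : (M *m evec R j) i 0 = M i j.
Proof.
rewrite mxE (bigD1 j)//= big1 => [|k kj]; rewrite /evec mxE ?eqxx.
  by rewrite mulr1 addr0.
by rewrite (negPf kj) mulr0.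
Qed.

(** The entry is a coordinate of the image of a unit basis vector. Comparing with the supremum
    requires the set to be bounded above, hence the constant [K]. *)
Lemma ler_mnorm2 M i j : `|M i j| <= mnorm2 M.
Proof.
apply: (@le_trans _ _ (vnorm2 (M *m evec R j))).
  by rewrite -mul_evec; exact: ler_vnorm2.
apply: ub_le_sup; last by exists (evec R j) => //; exact: vnorm2_evec.
have [K K0 HK] := l2norm_linear_bound M.
exists K => _ [v /= v1 <-]; rewrite vnorm2E -[K]mulr1 -v1.
apply: le_trans (HK _); apply: eq_l2norm_le.
by move=> k; rewrite mxE; apply: eq_bigr => l _; rewrite mulrC.
Qed.

Lemma mnorm2_ge0 M : (0 < n)%N -> 0 <= mnorm2 M.
Proof. by move=> n0; apply: le_trans (ler_mnorm2 M (Ordinal n0) (Ordinal n0)). Qed.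

Lemma frobE (p : nat) T : frob p T = l2norm (fun t : p.-tuple 'I_n => T t).
Proof. by []. Qed.

(** The index type in [teval] depends on [size us]; fixing the length as [p] avoids transporting
    tuples. *)
Lemma tevalE (p : nat) T (us : seq 'cV[R]_n) : size us = p ->
  teval T us = \sum_(t : p.-tuple 'I_n)
     T t * \prod_(k < p) (nth 0 us k) (tnth t k) 0.
Proof. by move=> <-. Qed.

(** On entries, the change of variables is the linear map given by the [p]-fold Kronecker power of
    [M]. *)
Lemma tchangeE (p : nat) T M (t : p.-tuple 'I_n) :
  tchange T M t =
  \sum_(s : p.-tuple 'I_n) T s * \prod_(k < p) M (tnth s k) (tnth t k).
Proof.
rewrite /tchange (@tevalE p) ?size_map ?size_tuple//.
apply: eq_bigr => s _; congr (_ * _); apply: eq_bigr => k _.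
by rewrite (nth_map (tnth t k)) ?size_tuple// -tnth_nth mul_evec.
Qed.

Lemma teval_evec (p : nat) T (t : p.-tuple 'I_n) :
  teval T [seq evec R i | i <- t] = T t.
Proof.
rewrite (@tevalE p) ?size_map ?size_tuple// (bigD1 t)//= [X in _ + X]big1 ?addr0.
  rewrite big1 ?mulr1// => k _.
  by rewrite (nth_map (tnth t k)) ?size_tuple// -tnth_nth /evec mxE !eqxx.
move=> s st; have [k skt] : exists k, tnth s k != tnth t k.
  apply/existsP; apply: contraNT st; rewrite negb_exists => /forallP st.
  by apply/eqP/eq_from_tnth => k; apply/eqP; rewrite -[_ == _]negbK st.
rewrite (bigD1 k)//= (nth_map (tnth t k)) ?size_tuple//.
by rewrite /evec mxE -tnth_nth (negPf skt) mul0r mulr0.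
Qed.

(** An entry is the value of the tensor at unit basis vectors; the sum of all absolute entries
    bounds the set in the supremum. *)
Lemma ler_tnorm2 (p : nat) T (t : p.-tuple 'I_n) : `|T t| <= tnorm2 p T.
Proof.
rewrite -[T t]teval_evec; apply: ub_le_sup; last first.
  exists (map_tuple (fun i => evec R i) t) => //= k.
  by rewrite tnth_map vnorm2_evec.
exists (\sum_(s : p.-tuple 'I_n) `|T s|) => _ [u /= u1 <-].
rewrite (@tevalE p) ?size_tuple//.
apply: le_trans (ler_norm_sum _ _ _) _; apply: ler_sum => s _.
rewrite normrM ler_piMr// normr_prod.
apply: prodr_ile1 => k _; rewrite normr_ge0/= -tnth_nth.
by rewrite (le_trans (ler_vnorm2 _ _))// u1.
Qed.

Lemma frob_le_const (p : nat) T (d : R) : (forall t : p.-tuple 'I_n, `|T t| <= d) ->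
  frob p T <= #|{: p.-tuple 'I_n}|%:R * d.
Proof. exact: (@ler_l2norm_const _ _ (fun t : p.-tuple 'I_n => T t)). Qed.

Lemma frob_tchangeC (p : nat) T U M :
  frob p (tchange (tsub T U) M) = frob p (tchange (tsub U T) M).
Proof.
rewrite !frobE -[RHS]l2normN; apply: eq_l2norm => t; rewrite !tchangeE -sumrN.
by apply: eq_bigr => s _; rewrite /tsub -mulNr opprB.
Qed.

Lemma frob_tfix_triangle (p : nat) T U V v :
  frob p (tfix (tsub T U) v) <= frob p (tfix (tsub V T) v) + frob p (tfix (tsub V U) v).
Proof.
rewrite [X in X + _]frobE -l2normN; apply: le_trans (ler_l2normD _ _).
apply: eq_l2norm_le => t; rewrite /tfix -sumrN -big_split/=.
by apply: eq_bigr => i _; rewrite /tsub; ring.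
Qed.

Lemma frob_tchange_triangle (p : nat) T U V M :
  frob p (tchange (tsub T U) M) <=
  frob p (tchange (tsub T V) M) + frob p (tchange (tsub V U) M).
Proof.
apply: le_trans (ler_l2normD _ _).
apply: eq_l2norm_le => t; rewrite !tchangeE -big_split/=.
by apply: eq_bigr => s _; rewrite /tsub -mulrDl addrA subrK.
Qed.

Lemma frob_tchange_le (p : nat) M : exists2 K : R, 0 <= K &
  forall T, frob p (tchange T M) <= K * frob p T.
Proof.
have [K K0 HK] := l2norm_linear_bound
  (fun t s : p.-tuple 'I_n => \prod_(k < p) M (tnth s k) (tnth t k)).
exists K => // T; apply: le_trans (HK _).
by apply: eq_l2norm_le => t; rewrite tchangeE.
Qed.

(** By [ler_norm_prodB], the Kronecker powers of [M] and [N] differ entrywise by at most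
    [p c^p e]. *)
Lemma frob_tchange_dist (p : nat) T M (N : 'M[R]_n) (c e : R) :
  1 <= c -> (forall i j, `|M i j| <= c) -> (forall i j, `|N i j| <= c) ->
  (forall i j, `|M i j - N i j| <= e) ->
  frob p (tchange T M) <= frob p (tchange T N) +
    #|{: p.-tuple 'I_n}|%:R * (#|{: p.-tuple 'I_n}|%:R * (p%:R * c ^+ p * e)) * frob p T.
Proof.
move=> c1 Mc Nc MN; rewrite addrC.
apply: le_trans (lerD (ler_l2norm_linear _ (A := fun t s : p.-tuple 'I_n =>
  \prod_(k < p) M (tnth s k) (tnth t k) - \prod_(k < p) N (tnth s k) (tnth t k)) _)
  (lexx _)); last by move=> t s; exact: ler_norm_prodB.
apply: le_trans (ler_l2normD _ _).
apply: eq_l2norm_le => t; rewrite !tchangeE -big_split/=.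
by apply: eq_bigr => s _; rewrite mulrBr subrK.
Qed.

Lemma prod_delta (p : nat) (r t : p.-tuple 'I_n) :
  \prod_(k < p) ((tnth r k == tnth t k)%:R : R) = (r == t)%:R.
Proof.
have [->|rt] := eqVneq r t; first by rewrite big1// => k _; rewrite eqxx.
have [k rtk] : exists k, tnth r k != tnth t k.
  apply/existsP; apply: contraNT rt; rewrite negb_exists => /forallP rt.
  by apply/eqP/eq_from_tnth => k; apply/eqP; rewrite -[_ == _]negbK rt.
by rewrite (bigD1 k)//= (negPf rtk) mul0r.
Qed.

(** The Kronecker power of the inverse matrix inverts the Kronecker power: both sums exchange, and
    the inner one factors into entries of [M *m invmx M]. *)
Lemma tchange_mulV (p : nat) T M (t : p.-tuple 'I_n) : M \in unitmx ->
  \sum_(s : p.-tuple 'I_n) tchange T M s *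
     \prod_(k < p) (invmx M) (tnth s k) (tnth t k) = T t.
Proof.
move=> uM.
under eq_bigr do rewrite tchangeE mulr_suml.
rewrite exchange_big/=.
transitivity (\sum_(r : p.-tuple 'I_n) T r * (r == t)%:R); last first.
  rewrite (bigD1 t)//= eqxx mulr1 big1 ?addr0// => r rt.
  by rewrite (negPf rt) mulr0.
apply: eq_bigr => r _; under eq_bigr do rewrite -mulrA -big_split/=.
rewrite -mulr_sumr; congr (_ * _).
have -> : (r == t)%:R = \prod_(k < p) \sum_(i < n)
    M (tnth r k) i * (invmx M) i (tnth t k).
  rewrite -prod_delta; apply: eq_bigr => k _.
  by have /matrixP/(_ (tnth r k) (tnth t k)) := mulmxV uM; rewrite !mxE.
rewrite bigA_distr_bigA/=.
rewrite (reindex (fun g : {ffun 'I_p -> 'I_n} => mktuple g))/=; last first.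
  apply: onW_bij; exists (fun s : p.-tuple 'I_n => [ffun k => tnth s k]).
    by move=> g; apply/ffunP => k; rewrite ffunE tnth_mktuple.
  by move=> s; apply: eq_from_tnth => k; rewrite tnth_mktuple ffunE.
by apply: eq_bigr => g _; apply: eq_bigr => k _; rewrite tnth_mktuple.
Qed.

Lemma frob_le_tchange (p : nat) M : M \in unitmx -> exists2 K : R, 0 <= K &
  forall T, frob p T <= K * frob p (tchange T M).
Proof.
move=> uM; have [K K0 HK] := l2norm_linear_bound
  (fun t s : p.-tuple 'I_n => \prod_(k < p) (invmx M) (tnth s k) (tnth t k)).
exists K => // T; apply: le_trans (HK _).
by apply: eq_l2norm_le => t; rewrite tchange_mulV.
Qed.

(** Invertibility of [M] bounds [frob p T] by a multiple of [frob p (tchange T M)], which turns the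
    error of [frob_tchange_dist] into a relative one. The cap [S] on [e] keeps [K] independent of
    [N]. *)
Lemma frob_tchange_near (p : nat) M (S : R) : M \in unitmx -> 0 <= S ->
  exists2 K : R, 0 <= K & forall (N : 'M[R]_n) e T, 0 <= e -> e <= S ->
    (forall i j, `|N i j - M i j| <= e) ->
    frob p (tchange T N) <= (1 + K * e) * frob p (tchange T M) /\
    (1 - K * e) * frob p (tchange T M) <= frob p (tchange T N).
Proof.
move=> uM S0; have [K K0 HK] := frob_le_tchange p uM.
(* [c] dominates 1, all entries of [M], and all entries of any [N] within [S] of [M]. *)
pose c := 1 + \sum_i \sum_j `|M i j| + S.
have sM i j : `|M i j| <= \sum_i \sum_j `|M i j|.
  rewrite (bigD1 i)//= (bigD1 j)//= -addrA lerDl addr_ge0// ?sumr_ge0// => k _.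
  exact: sumr_ge0.
have s0 : 0 <= \sum_i \sum_j `|M i j|.
  by apply: sumr_ge0 => i _; exact: sumr_ge0.
have c1 : 1 <= c by rewrite /c; lra.
have c0 : 0 <= c by lra.
have Mc i j : `|M i j| <= c by have := sM i j; rewrite /c; lra.
pose m : R := #|{: p.-tuple 'I_n}|%:R.
pose K1 := m * (m * (p%:R * c ^+ p)).
have K10 : 0 <= K1 by rewrite /K1 /m !mulr_ge0// exprn_ge0.
exists (K1 * K) => [|N e T e0 eS NM]; first exact: mulr_ge0.
have Nc i j : `|N i j| <= c.
  have := ler_normD (N i j - M i j) (M i j); rewrite subrK.
  have := sM i j; have := NM i j; rewrite /c; lra.
have MN i j : `|M i j - N i j| <= e by rewrite distrC.
have := frob_tchange_dist p T c1 Nc Mc NM; have := frob_tchange_dist p T c1 Mc Nc MN.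
have -> : #|{: p.-tuple 'I_n}|%:R * (#|{: p.-tuple 'I_n}|%:R * (p%:R * c ^+ p * e))
  = K1 * e by rewrite /K1 /m; ring.
have := ler_wpM2l (mulr_ge0 K10 e0) (HK T).
move: (frob p (tchange T M)) (frob p (tchange T N)) (frob p T) => a b d h1 h2 h3.
split; lra.
Qed.

Lemma frob_tfix_le (p : nat) T v :
  frob p (tfix T v) <= #|{: p.-tuple 'I_n}|%:R * n%:R * vnorm2 v * frob p.+1 T.
Proof.
rewrite -!mulrA; apply: frob_le_const => l; rewrite /tfix.
apply: le_trans (ler_norm_sum _ _ _) _.
apply: (@le_trans _ _ (\sum_(i < n) vnorm2 v * frob p.+1 T)).
  apply: ler_sum => i _; rewrite normrM ler_pM ?ler_vnorm2//.
  exact: (ler_l2norm (fun t : p.+1.-tuple 'I_n => T t) (cons_tuple i l)).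
by rewrite sumr_const card_ord -[_ *+ _]mulr_natl.
Qed.

(** * The secant update as an orthogonal projection *)

Section SecantUpdate.
Variables (p : nat) (C0 Ct C : tensor R n) (M : 'M[R]_n) (v : 'cV[R]_n).
Hypothesis hC : secant_min p.+1 C0 M v Ct C.

Lemma secant_min_tfix :
  frob p (tfix (tsub Ct C0) v) = frob p (tfix (tsub C C0) v).
Proof.
have [_ [Cv _]] := hC; apply: eq_l2norm => l; rewrite /tfix /tsub.
have := Cv l; rewrite /tfix => E.
by under eq_bigr do rewrite mulrBr; rewrite sumrB -E -sumrB; apply: eq_bigr => i _;
  rewrite mulrBr.
Qed.

(** The whole line [C + tau (Ct - C)] is symmetric and satisfies the secant equation, so [C] is
    minimal along it and [l2norm_min_pythagoras] applies. *)
Lemma secant_min_pythagoras : tsym p.+1 Ct ->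
  frob p.+1 (tchange (tsub Ct C0) M) ^+ 2 =
  frob p.+1 (tchange (tsub C C0) M) ^+ 2 + frob p.+1 (tchange (tsub Ct C) M) ^+ 2.
Proof.
move=> symCt; have [symC [Cv minC]] := hC.
rewrite -l2norm_min_pythagoras => [|tau].
  congr (_ ^+ 2); apply: eq_l2norm => t; rewrite !tchangeE -big_split/=.
  by apply: eq_bigr => s _; rewrite /tsub; ring.
pose C' : tensor R n := fun l => C l + tau * tsub Ct C l.
apply: le_trans (minC C' _ _) _.
- by move=> t t' tt'; rewrite /C' /tsub (symC _ _ tt') (symCt _ _ tt').
- move=> l.
  transitivity (tfix C v l + tau * (tfix Ct v l - tfix C v l)).
    rewrite /tfix -sumrB mulr_sumr -big_split/=.
    by apply: eq_bigr => i _; rewrite /C' /tsub; ring.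
  by rewrite Cv subrr mulr0 addr0.
- apply: eq_l2norm_le => t; rewrite !tchangeE mulr_sumr -big_split/=.
  by apply: eq_bigr => s _; rewrite /C' /tsub; ring.
Qed.

End SecantUpdate.

End Tensors.

(** * Symmetry of higher partial derivatives *)

Section Clairaut.
Variables (R : realType) (n : nat).
Implicit Types (g : 'cV[R]_n -> R) (x v w : 'cV[R]_n).

Lemma is_derive_along g x v (t : R) : derivable g (x + t *: v) v ->
  is_derive t 1 (fun r : R => g (x + r *: v)) ('D_v g (x + t *: v)).
Proof.
have E : (fun h : R => h^-1 *: (g (x + (h *: (1 : R) + t) *: v) - g (x + t *: v)))
  = (fun h : R => h^-1 *: (g (h *: v + (x + t *: v)) - g (x + t *: v))).
  apply/funext => h; congr (_ *: (g _ - _)).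
  by rewrite [h *: (1:R)]mulr1 scalerDl addrCA.
move=> dg; apply: DeriveDef.
  by rewrite /derivable/= E.
by rewrite /derive/= E.
Qed.

Lemma mean_value_along g x v (h : R) : 0 < h ->
  (forall y, derivable g y v) ->
  exists2 t, 0 < t < h & g (x + h *: v) - g x = h * 'D_v g (x + t *: v).
Proof.
move=> h0 dg; set phi := fun r : R => g (x + r *: v).
have dphi (t : R) : is_derive t 1 phi ('D_v g (x + t *: v)).
  exact: is_derive_along.
have cphi : {within `[0, h], continuous phi}.
  apply: continuous_subspaceT => t; apply: differentiable_continuous.
  by apply/derivable1_diffP; have [] := dphi t.
have [t] := MVT h0 (fun t _ => dphi t) cphi.
rewrite in_itv/= => th; rewrite /phi scale0r addr0 subr0 mulrC => E.
by exists t.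
Qed.

(** Two mean value theorems: along [v] for the increment [phi] of [g] in direction [w], then along
    [w] for the derivative of [g] in direction [v]. *)
Lemma second_difference_mean_value g x v w (h : R) : 0 < h ->
  (forall y, derivable g y v) -> (forall y, derivable ('D_v g) y w) ->
  exists t r, [/\ 0 < t < h, 0 < r < h &
  g (x + h *: v + h *: w) - g (x + h *: v) - (g (x + h *: w) - g x)
  = h ^+ 2 * 'D_w ('D_v g) (x + t *: v + r *: w)].
Proof.
move=> h0 dv dw; set phi := fun y => g (y + h *: w) - g y.
have dshift y : derivable (fun z => g (z + h *: w)) y v
    /\ 'D_v (fun z => g (z + h *: w)) y = 'D_v g (y + h *: w).
  have := dv (y + h *: w); rewrite /derivable /derive.
  have -> : (fun k : R => k^-1 *: (((fun z => g (z + h *: w)) \o shift y) (k *: v)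
        - g (y + h *: w)))
      = (fun k : R => k^-1 *: ((g \o shift (y + h *: w)) (k *: v)
        - g (y + h *: w))).
    by apply/funext => k /=; rewrite addrA.
  by [].
have dphi y : derivable phi y v.
  by apply: derivableB => //; case: (dshift y).
have Dphi y : 'D_v phi y = 'D_v g (y + h *: w) - 'D_v g y.
  have [dy Ey] := dshift y.
  by rewrite (deriveB dy (dv y)) Ey.
have [t th Et] := @mean_value_along phi x v h h0 dphi.
have [r rh Er] := @mean_value_along ('D_v g) (x + t *: v) w h h0 dw.
exists t, r; split => //.
by rewrite -/(phi (x + h *: v)) -/(phi x) Et Dphi Er mulrA expr2.
Qed.

(* The second difference is symmetric in [v] and [w], so both mixed derivatives take the same
   value at points close to [x]. *)
Lemma clairaut g x v w :
  (forall y, derivable g y v) -> (forall y, derivable g y w) ->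
  (forall y, derivable ('D_v g) y w) -> (forall y, derivable ('D_w g) y v) ->
  {for x, continuous ('D_w ('D_v g))} -> {for x, continuous ('D_v ('D_w g))} ->
  'D_w ('D_v g) x = 'D_v ('D_w g) x.
Proof.
move=> dv dw dvw dwv cvw cwv.
apply/eqP; rewrite -subr_eq0 -normr_le0; apply/ler_addgt0Pl => e e0.
rewrite addr0.
have e2 : 0 < e / 2 by rewrite divr_gt0.
have /nbhs_normP[r1 /= r10 B1] : \forall y \near x,
    `|'D_w ('D_v g) x - 'D_w ('D_v g) y| < e / 2.
  by move/cvgrPdist_lt : cvw; apply.
have /nbhs_normP[r2 /= r20 B2] : \forall y \near x,
    `|'D_v ('D_w g) x - 'D_v ('D_w g) y| < e / 2.
  by move/cvgrPdist_lt : cwv; apply.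
pose r := Num.min r1 r2; have r0 : 0 < r by rewrite lt_min r10 r20.
(* The choice of [h] gives [h * M = r / 2], so all intermediate points lie in both continuity balls;
   the summand 1 keeps [M] positive if [v] and [w] vanish. *)
pose M := `|v| + `|w| + 1; have M0 : 0 < M by rewrite ltr_wpDl// addr_ge0.
pose h := r / (M * 2); have h0 : 0 < h by rewrite divr_gt0// mulr_gt0.
have close (s t : R) : 0 < s < h -> 0 < t < h -> `|s *: v + t *: w| < r.
  move=> /andP[s0 sh] /andP[t0 th].
  apply: le_lt_trans (ler_normD _ _) _; rewrite !normrZ !gtr0_norm//.
  apply: (@le_lt_trans _ _ (h * M)).
    apply: (@le_trans _ _ (h * `|v| + h * `|w|)).
      by rewrite lerD// ler_wpM2r// ltW.
    by rewrite -mulrDr ler_wpM2l ?(ltW h0)// /M lerDl.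
  rewrite /h invfM -!mulrA [M^-1 * _]mulrCA mulVf ?gt_eqF// mulr1.
  by rewrite ltr_pdivrMr//; lra.
have [s1 [t1 [s1h t1h E1]]] := @second_difference_mean_value g x v w h h0 dv dvw.
have [s2 [t2 [s2h t2h E2]]] := @second_difference_mean_value g x w v h h0 dw dwv.
have E : 'D_w ('D_v g) (x + s1 *: v + t1 *: w)
    = 'D_v ('D_w g) (x + s2 *: w + t2 *: v).
  apply: (@mulfI _ (h ^+ 2)); first by rewrite expf_neq0// gt_eqF.
  apply: etrans (esym E1) (etrans _ E2).
  rewrite (addrAC x (h *: v) (h *: w)).
  move: (g (x + _ + _)) (g (x + h *: v)) (g (x + h *: w)) (g x) => a b c d; ring.
have ball_addr y d : `|d| < r -> y = x + d -> `|x - y| < r1 /\ `|x - y| < r2.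
  rewrite lt_min => /andP[d1 d2] ->.
  have -> : x - (x + d) = - d by rewrite opprD addrA subrr add0r.
  by rewrite normrN; split; [exact: d1|exact: d2].
have [b1 _] := ball_addr (x + s1 *: v + t1 *: w) _ (close _ _ s1h t1h) (esym (addrA _ _ _)).
have [_ b2] := ball_addr (x + s2 *: w + t2 *: v) _ (close _ _ t2h s2h)
  (etrans (addrAC _ _ _) (esym (addrA _ _ _))).
have N1 := B1 _ b1; have N2 := B2 _ b2; rewrite /= E in N1.
rewrite -(subrKA ('D_v ('D_w g) (x + s2 *: w + t2 *: v))) (splitr e).
apply: le_trans (ler_normD _ _) _; apply: lerD; apply: ltW; first exact: N1.
by rewrite distrC; exact: N2.
Qed.

Variables (p : nat) (f : 'cV[R]_n -> R).
Hypothesis hf : Cp p f.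

Lemma iterpartial_swap i j l : ((size l).+2 <= p)%N ->
  iterpartial [:: i, j & l] f = iterpartial [:: j, i & l] f.
Proof.
have [df cf] := hf; move=> lp; apply/funext => x /=.
apply: clairaut => [y|y|y|y||].
- by apply: df; exact: ltnW.
- by apply: df; exact: ltnW.
- exact: (df (j :: l)).
- exact: (df (i :: l)).
- exact: (cf [:: i, j & l]).
- exact: (cf [:: j, i & l]).
Qed.

(** Adjacent swaps carry [i] to the front; sorting by such moves then yields invariance under all
    permutations. *)
Lemma iterpartial_rotate i l1 l2 : (size (l1 ++ i :: l2) <= p)%N ->
  iterpartial (l1 ++ i :: l2) f = iterpartial (i :: l1 ++ l2) f.
Proof.
elim: l1 => [//|j l1 IH] sp.
rewrite cat_cons [LHS]/= IH; last exact: ltnW.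
apply: (@iterpartial_swap j i (l1 ++ l2)).
by move: sp; rewrite /= !size_cat /= addnS.
Qed.

Lemma iterpartial_perm l1 l2 : (size l1 <= p)%N -> perm_eq l1 l2 ->
  iterpartial l1 f = iterpartial l2 f.
Proof.
elim: l1 l2 => [|i l1 IH] l2 sp; first by rewrite perm_sym => /perm_nilP ->.
move=> l12; have il2 : i \in l2 by rewrite -(perm_mem l12) mem_head.
have sl2 := perm_size l12; move: l12 sl2.
case/splitPr: il2 => t1 t2 l12 sl2.
rewrite iterpartial_rotate -?sl2//=.
have l1t : perm_eq l1 (t1 ++ t2).
  by rewrite -(perm_cons i) (perm_trans l12)// -cat1s perm_catCA.
by rewrite (IH (t1 ++ t2)) // ltnW.
Qed.

Lemma Dtensor_sym x : tsym p (Dtensor f x).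
Proof.
by move=> t t' tt'; rewrite /Dtensor (@iterpartial_perm t t')// size_tuple.
Qed.

End Clairaut.

(** * The averaged derivative along a step *)

Lemma Rintegral01_close (R : realType) (g : R -> R) (a M : R) :
  continuous g -> (forall t, 0 <= t <= 1 -> `|g t - a| <= M) ->
  `|Rintegral (@lebesgue_measure R) `[0%R, 1%R] g - a| <= M.
Proof.
move=> cg gM; set mu := @lebesgue_measure R.
have mI : measurable (`[0%R, 1%R] : set R) by exact: measurable_itv.
have cint (h : R -> R) : continuous h -> mu.-integrable `[0%R, 1%R]%classic (EFin \o h).
  move=> ch; apply: continuous_compact_integrable; first exact: segment_compact.
  exact: continuous_subspaceT.
have mu1 : fine (mu `[0%R, 1%R]%classic) = 1.
  by rewrite /mu lebesgue_measure_itv/= lte_fin ltr01 -EFinB/= subr0.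
have icst (b : R) : Rintegral mu `[0%R, 1%R]%classic (fun=> b) = b by rewrite Rintegral_cst// mu1 mulr1.
have ccst (b : R) : continuous (fun _ : R => b) by exact: cst_continuous.
have cga : continuous (fun t => g t - a).
  by move=> t; apply: cvgB; [exact: cg|exact: cvg_cst].
rewrite -{1}[a]icst -RintegralB//; [|exact: cint|exact: cint (ccst a)].
apply: le_trans (le_normr_Rintegral _ _) _ => //; first exact: cint cga.
rewrite -[leRHS]icst; apply: le_Rintegral => //.
- by apply: (cint (fun t => `|g t - a|)) => t; apply: cvg_norm; exact: cga.
- exact: (cint _ (ccst M)).
Qed.

Section AverageDerivative.
Variables (R : realType) (n p : nat) (f : 'cV[R]_n -> R).
Hypothesis hf : Cp p f.

Lemma avgD_sym x s : tsym p (avgD f x s).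
Proof.
move=> t t' tt'; rewrite /avgD; congr Rintegral.
by apply/funext => r; exact: (Dtensor_sym hf).
Qed.

Lemma avgD_close (L : R) (x s y : 'cV[R]_n) (t : p.-tuple 'I_n) : 0 <= L ->
  (forall z, tnorm2 p (tsub (Dtensor f z) (Dtensor f y)) <= L * vnorm2 (z - y)) ->
  `|avgD f x s t - Dtensor f y t| <= L * (vnorm2 (x - y) + vnorm2 (x + s - y)).
Proof.
move=> L0 lip; apply: Rintegral01_close.
  move=> r; apply: (@continuous_comp _ _ _ (fun r : R => x + r *: s)
      (fun z => Dtensor f z t)).
    apply: cvgD; first exact: cvg_cst.
    by apply: cvgZr_tmp; exact: cvg_id.
  by apply: hf.2; rewrite size_tuple.
move=> r /andP[r0 r1].
apply: le_trans (ler_tnorm2 (tsub (Dtensor f (x + r *: s)) (Dtensor f y)) t) _.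
apply: le_trans (lip _) _; rewrite ler_wpM2l//.
(* A point of the segment is a convex combination of its endpoints; the weights are then bounded by
   1. *)
have -> : x + r *: s - y = (1 - r) *: (x - y) + r *: (x + s - y).
  by apply/matrixP => i j; rewrite !mxE; ring.
apply: le_trans (vnorm2D _ _) _; rewrite !vnorm2Z !ger0_norm ?subr_ge0//.
by rewrite lerD// ler_piMl ?vnorm2_ge0//; lra.
Qed.

End AverageDerivative.

(** * Sequences that decrease up to summable errors *)

Section Summable.
Variable R : realType.
Implicit Types (b u w q e : nat -> R).

Lemma is_cvg_series_shift e (N : nat) :
  cvgn (series e) -> cvgn (series (fun k => e (k + N)%N)).
Proof.
move=> ce; have -> : series (fun k => e (k + N)%N)
    = (fun k => series e (k + N)%N - series e N).
  apply/funext => k; rewrite series_addn [series e N + _]addrC addrK.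
  by have /= := @big_addn _ 0 +%R 0%N (k + N) N xpredT e; rewrite add0n addnK => ->.
apply: is_cvgB; last exact: is_cvg_cst.
by apply/cvg_ex; exists (limn (series e)); rewrite (cvg_shiftn N (series e)).
Qed.

Lemma summable_bounded e : (forall k, 0 <= e k) -> cvgn (series e) ->
  exists2 S, 0 <= S & forall k, \sum_(0 <= j < k) e j <= S.
Proof.
move=> e0 ce; exists (limn (series e)).
  by apply: limr_ge => //; apply: nearW => k; exact: sumr_ge0.
move=> k; apply: (nondecreasing_cvgn_le _ ce).
by apply: nondecreasing_series.
Qed.

Lemma summable_term_le e S : (forall k, 0 <= e k) ->
  (forall k, \sum_(0 <= j < k) e j <= S) -> forall k, e k <= S.
Proof.
move=> e0 eS k; apply: le_trans (eS k.+1).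
by rewrite big_nat_recr//= lerDr sumr_ge0.
Qed.

(** The quantity [b k + 1] grows by a factor of at most [1 + 2 e k <= expR (2 e k)], and the product
    of these factors is bounded by [expR (2 S)]. *)
Lemma quasi_decreasing_bounded b e : (forall k, 0 <= e k) ->
  cvgn (series e) -> (forall k, 0 <= b k) ->
  (forall k, b k.+1 <= (1 + e k) * b k + e k) ->
  exists M, forall k, b k <= M.
Proof.
move=> e0 ce b0 bS; have [S S0 eS] := summable_bounded e0 ce.
suff bexp k : b k + 1 <= expR (2 * \sum_(0 <= j < k) e j) * (b 0 + 1).
  exists (expR (2 * S) * (b 0 + 1)) => k.
  apply: (@le_trans _ _ (b k + 1)); first by rewrite lerDl.
  apply: le_trans (bexp k) _.
  by rewrite ler_wpM2r ?addr_ge0// ler_expR ler_wpM2l.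
elim: k => [|k IH]; first by rewrite big_geq// mulr0 expR0 mul1r.
rewrite big_nat_recr//= [2 * _]mulrDr expRD mulrAC.
have step : b k.+1 + 1 <= (1 + 2 * e k) * (b k + 1).
  have := bS k; have := mulr_ge0 (e0 k) (b0 k); have := e0 k; lra.
apply: le_trans step _; rewrite mulrC; apply: ler_pM => //.
- by rewrite addr_ge0.
- by rewrite addr_ge0// mulr_ge0.
- exact: expR_ge1Dx.
Qed.

(** Subtracting the partial sums of [e] from [b] leaves a nonincreasing sequence bounded below by
    [- S]. *)
Lemma quasi_decreasing_is_cvg b e : (forall k, 0 <= e k) ->
  cvgn (series e) -> (forall k, 0 <= b k) ->
  (forall k, b k.+1 <= b k + e k) -> cvgn b.
Proof.
move=> e0 ce b0 bS; have [S S0 eS] := summable_bounded e0 ce.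
have -> : b = (fun k => (b k - series e k) + series e k).
  by apply/funext => k; rewrite subrK.
apply: is_cvgD => //; apply: nonincreasing_is_cvgn.
  apply/nonincreasing_seqP => k.
  by rewrite seriesSr; have := bS k; lra.
exists (- S) => _ [k _ <-].
have : series e k <= S by exact: eS.
have := b0 k; lra.
Qed.

(* [q^2 = (u + w) (u - w)], and up to a summable error [u - w] is at most the decrease of [b],
   which converges. *)
Lemma pythagoras_cvg0 b u w q e : (forall k, 0 <= e k) ->
  cvgn (series e) -> (forall k, 0 <= b k) -> (forall k, 0 <= u k) ->
  (forall k, 0 <= w k) -> (forall k, 0 <= q k) ->
  (forall k, u k ^+ 2 = q k ^+ 2 + w k ^+ 2) ->
  (forall k, u k <= (1 + e k) * b k + e k) ->
  (forall k, b k.+1 <= (1 + e k) * (w k + e k)) ->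
  q @ \oo --> 0.
Proof.
move=> e0 ce b0 u0 w0 q0 uqw ub bw.
have [S S0 eS] := summable_bounded e0 ce.
have eleS := summable_term_le e0 eS.
have wu k : w k <= u k.
  rewrite -(@ler_pXn2r _ 2) ?nnegrE//.
  by rewrite uqw lerDr sqr_ge0.
pose c := 2 + 2 * S.
have c0 : 0 <= c by rewrite /c; lra.
have bS k : b k.+1 <= (1 + c * e k) * b k + c * e k.
  apply: le_trans (bw k) _.
  apply: (@le_trans _ _ ((1 + e k) * ((1 + e k) * b k + 2 * e k))).
    rewrite ler_wpM2l ?addr_ge0//; have := wu k; have := ub k; lra.
  have eeS : e k * e k <= S * e k by rewrite ler_wpM2r.
  have := ler_wpM2r (b0 k) eeS.
  have := mulr_ge0 (mulr_ge0 S0 (e0 k)) (b0 k); rewrite /c; lra.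
have ce' (d : R) : cvgn (series (fun k => d * e k)) by exact: is_cvg_seriesZ.
have [M bM] := quasi_decreasing_bounded (fun k => mulr_ge0 c0 (e0 k)) (ce' c) b0 bS.
have M0 : 0 <= M := le_trans (b0 0%N) (bM 0%N).
(* With [b] bounded, the multiplicative error becomes a summable additive one, so [b] converges. *)
have eb k : e k * b k <= M * e k by rewrite mulrC ler_wpM2r.
have cb : cvgn b.
  apply: (@quasi_decreasing_is_cvg b (fun k => c * (M + 1) * e k)) => //.
  - by move=> k; rewrite !mulr_ge0// addr_ge0.
  - move=> k; apply: le_trans (bS k) _.
    have := ler_wpM2l c0 (eb k); lra.
have e_cvg0 : e @ \oo --> 0 by exact: cvg_series_cvg_0.
(* [K] bounds [u + w], since [w <= u <= (1 + S) M + S]. The bracket multiplied by [K] below bounds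
   [u - w], with [e b], [e w] and [e^2] all estimated by multiples of [e]. *)
pose K := 2 * ((1 + S) * M + S).
have db0 : (fun k => K * (b k - b k.+1 + (2 * M + S * M + 2 + 2 * S) * e k)) @ \oo --> 0.
  rewrite -[X in _ --> X](mulr0 K); apply: cvgMl_tmp.
  rewrite -[X in _ --> X]addr0; apply: cvgD.
    rewrite -(subrr (limn b)); apply: cvgB => //.
    by rewrite (cvg_shiftS b).
  by rewrite -(mulr0 (2 * M + S * M + 2 + 2 * S)); apply: cvgMl_tmp.
have q2 : (fun k => q k ^+ 2) @ \oo --> 0.
  apply: (squeeze_cvgr _ (cvg_cst 0) db0); apply: nearW => k.
  rewrite sqr_ge0/=.
  have -> : q k ^+ 2 = (u k + w k) * (u k - w k).
    by have := uqw k; rewrite mulrC -subr_sqr => ->; rewrite addrK.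
  have uK : u k <= (1 + S) * M + S.
    apply: le_trans (ub k) _; apply: lerD => //.
    by apply: ler_pM => //; rewrite ?addr_ge0// lerD2l.
  apply: (@ler_pM _ (u k + w k) _ (u k - w k)).
  - exact: addr_ge0.
  - by rewrite subr_ge0.
  - by rewrite /K; have := wu k; lra.
  - have ew : e k * w k <= e k * ((1 + S) * M + S).
      by rewrite ler_wpM2l// (le_trans (wu k)).
    have ee : e k * e k <= e k * S by rewrite ler_wpM2l.
    have := ub k; have := bw k; have := eb k.
    have := mulr_ge0 S0 (e0 k); have := mulr_ge0 (mulr_ge0 M0 S0) (e0 k).
    have := mulr_ge0 M0 (e0 k).
    move: ew ee (e0 k); lra.
have -> : q = (fun k => Num.sqrt (q k ^+ 2)).
  by apply/funext => k; rewrite sqrtr_sqr ger0_norm.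
rewrite -[X in _ --> X]sqrtr0; apply: (cvg_comp _ _ q2).
exact: sqrt_continuous.
Qed.

End Summable.

(** * Convergence of the secant updates *)

Unset Implicit Arguments.

Theorem mainTheorem9 (R : realType) (n p : nat) (hp : (2 <= p)%N)
  (f : 'cV[R]_n -> R) (hf : Cp p f)
  (hLip : exists L : R, forall x y : 'cV[R]_n,
      tnorm2 p (tsub (Dtensor f x) (Dtensor f y)) <= L * vnorm2 (x - y))
  (x : nat -> 'cV[R]_n) (W : nat -> 'M[R]_n) (C : nat -> tensor R n)
  (xs : 'cV[R]_n) (Ws : 'M[R]_n)
  (hs : forall k, x k.+1 - x k != 0)
  (hW : forall k, W k \in unitmx)
  (hC0 : tsym p (C 0%N))
  (hC : forall k, secant_min p (C k) (W k) (x k.+1 - x k)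
                    (avgD f (x k) (x k.+1 - x k)) (C k.+1))
  (hx : x @ \oo --> xs) (hWc : W @ \oo --> Ws) (hWs : Ws \in unitmx)
  (hsumx : cvg (series (fun k => vnorm2 (x k - xs)) @ \oo))
  (hsumW : cvg (series (fun k => mnorm2 (W k - Ws)) @ \oo)) :
  (fun k => frob p.-1 (tfix (tsub (C k) (Dtensor f xs)) (x k.+1 - x k))
            / vnorm2 (x k.+1 - x k)) @ \oo --> 0.
Proof.
(* From here on the order of the tensors is [p.+1], and fixing one argument leaves order [p]. *)
case: p hp hf hLip hC0 hC => [//|p] _ hf [L0 hLip0] _ hC; rewrite [_.-1]/=.
(* In dimension 0 every step would be zero. *)
have n_gt0 : (0 < n)%N.
  by rewrite lt0n; apply: contraNneq (hs 0%N) => n0; subst n; rewrite flatmx0.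
pose s k := x k.+1 - x k; pose D := Dtensor f xs; pose T k := avgD f (x k) (s k).
(* The given Lipschitz constant carries no sign condition. *)
pose L := `|L0|.
have L_ge0 : 0 <= L by exact: normr_ge0.
pose d k := L * (vnorm2 (x k - xs) + vnorm2 (x k.+1 - xs)).
have d_ge0 k : 0 <= d k by apply: mulr_ge0 => //; apply: addr_ge0; exact: vnorm2_ge0.
have hT k (t : p.+1.-tuple 'I_n) : `|tsub (T k) D t| <= d k.
  rewrite /d -[x k.+1](subrK (x k)) [_ + x k]addrC.
  apply: (avgD_close hf) => // z; apply: le_trans (hLip0 _ _) _.
  by rewrite ler_wpM2r ?vnorm2_ge0// ler_norm.
have sum_d : cvgn (series d).
  have -> : d = L *: ((fun k => vnorm2 (x k - xs)) + (fun k => vnorm2 (x k.+1 - xs))) by [].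
  apply: is_cvg_seriesZ; apply: is_cvg_seriesD; first exact: hsumx.
  have -> : (fun k => vnorm2 (x k.+1 - xs)) = (fun k => vnorm2 (x (k + 1)%N - xs)).
    by apply/funext => k; rewrite (addn1 k).
  exact: (@is_cvg_series_shift _ (fun k => vnorm2 (x k - xs)) 1%N).
pose eps k := mnorm2 (W k - Ws).
have eps_ge0 k : 0 <= eps k by exact: mnorm2_ge0.
have [S S0 epsS] := summable_bounded eps_ge0 hsumW.
have eps_le k : eps k <= S by exact: (summable_term_le eps_ge0 epsS).
have epsW k i j : `|W k i j - Ws i j| <= eps k.
  by have := ler_mnorm2 (W k - Ws) i j; rewrite !mxE.
have [K K0 near_star] := frob_tchange_near p.+1 hWs S0.
have [K2 K20 frob_le_star] := frob_le_tchange p.+1 hWs.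
have [K3 K30 star_le_frob] := frob_tchange_le p.+1 Ws.
pose a k E := frob p.+1 (tchange E (W k)).
pose b E := frob p.+1 (tchange E Ws).
have b_ge0 E : 0 <= b E by exact: l2norm_ge0.
have a_ge0 k E : 0 <= a k E by exact: l2norm_ge0.
have aS k E : a k E <= (1 + K * eps k) * b E.
  by have [] := near_star (W k) (eps k) E (eps_ge0 k) (eps_le k) (epsW k).
have bS k E : (1 - K * eps k) * b E <= a k E.
  by have [] := near_star (W k) (eps k) E (eps_ge0 k) (eps_le k) (epsW k).
(* Beyond [N] the lower comparison of norms can be inverted, by [1 / (1 - y) <= 1 + 2 y] for
   [0 <= y <= 1 / 2]. *)
have [N _ epsN] : \forall k \near \oo, K * eps k <= 1 / 2.
  have e0 : (fun k => K * eps k) @ \oo --> 0.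
    by rewrite -(mulr0 K); apply: cvgMl_tmp; exact: cvg_series_cvg_0.
  by apply: (cvgr_le _ e0); lra.
have a_le k E : (N <= k)%N -> a k E <= 2 * b E.
  move=> Nk; apply: le_trans (aS k E) _; rewrite ler_wpM2r//.
  by have := epsN k Nk; rewrite /=; lra.
have b_le k E : (N <= k)%N -> b E <= (1 + 2 * (K * eps k)) * a k E.
  move=> Nk; have h := epsN k Nk; rewrite /= in h.
  have y0 : 0 <= K * eps k by exact: mulr_ge0.
  have y1 : 0 <= 1 + 2 * (K * eps k) by lra.
  have y2 : 1 <= (1 + 2 * (K * eps k)) * (1 - K * eps k).
    have : 0 <= (K * eps k) * (1 / 2 - K * eps k) by rewrite mulr_ge0// subr_ge0.
    lra.
  apply: le_trans (ler_wpM2l y1 (bS k E)).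
  by rewrite [leRHS]mulrA -[leLHS]mul1r ler_wpM2r.
pose m : R := #|{: p.+1.-tuple 'I_n}|%:R.
have frobTD k : frob p.+1 (tsub (T k) D) <= m * d k by apply: frob_le_const => t.
have aTD k : (N <= k)%N -> a k (tsub (T k) D) <= 2 * K3 * m * d k.
  move=> Nk; apply: le_trans (a_le _ _ Nk) _; rewrite -!mulrA ler_wpM2l//.
  by apply: le_trans (star_le_frob _) _; rewrite ler_wpM2l.
(* One summable error for both effects: the first term compares the norms of [W k] and [Ws], the
   second bounds [T k - D] in the norm of [W k]. *)
pose e k := 2 * K * eps k + 2 * K3 * m * d k.
have m0 : 0 <= m by [].
have Keps0 k : 0 <= K * eps k by exact: mulr_ge0.
have Kd0 k : 0 <= 2 * K3 * m * d k by apply: mulr_ge0 => //; rewrite !mulr_ge0.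
have e_ge0 k : 0 <= e k by rewrite /e; have := Keps0 k; have := Kd0 k; lra.
have sum_e : cvgn (series e).
  have -> : e = (2 * K) *: eps + (2 * K3 * m) *: d by [].
  by apply: is_cvg_seriesD; apply: is_cvg_seriesZ.
pose q k := a k (tsub (C k.+1) (C k)).
have q_cvg0 : q @ \oo --> 0.
  (* The comparisons hold only from [N] on, so [pythagoras_cvg0] is applied to the shifted
     sequences. *)
  rewrite -(cvg_shiftn N q).
  apply: (@pythagoras_cvg0 _ (fun k => b (tsub (C (k + N)%N) D))
    (fun k => a (k + N)%N (tsub (T (k + N)%N) (C (k + N)%N)))
    (fun k => a (k + N)%N (tsub (T (k + N)%N) (C (k + N).+1))) _
    (fun k => e (k + N)%N)); [| |move=> k; exact: b_ge0|move=> k; exact: a_ge0|move=> k; exact: a_ge0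
    |move=> k; exact: a_ge0| | |].
  - by move=> k; exact: e_ge0.
  - exact: is_cvg_series_shift.
  - move=> k.
    exact: (secant_min_pythagoras (hC (k + N)%N) (avgD_sym hf _ _)).
  - move=> k; have Nk : (N <= k + N)%N by exact: leq_addl.
    move: (k + N)%N Nk => {}k Nk.
    have := frob_tchange_triangle p.+1 (T k) (C k) D (W k).
    rewrite [X in _ + X]frob_tchangeC -/(a k _) -/(a k _) -/(a k _).
    have := aTD k Nk; have := aS k (tsub (C k) D).
    have := mulr_ge0 (Keps0 k) (b_ge0 (tsub (C k) D)).
    have := mulr_ge0 (Kd0 k) (b_ge0 (tsub (C k) D)).
    have := Keps0 k; rewrite /e; lra.
  - move=> k; have Nk : (N <= k + N)%N by exact: leq_addl.
    rewrite addSn; move: (k + N)%N Nk => {}k Nk.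
    apply: le_trans (b_le k _ Nk) _.
    apply: ler_pM => //.
    + by have := Keps0 k; lra.
    + by rewrite /e; have := Kd0 k; lra.
    + have := frob_tchange_triangle p.+1 (C k.+1) D (T k) (W k).
      rewrite [X in X + _]frob_tchangeC -/(a k _) -/(a k _) -/(a k _).
      by have := aTD k Nk; have := Keps0 k; rewrite /e; lra.
pose K4 : R := #|{: p.-tuple 'I_n}|%:R * n%:R.
have K40 : 0 <= K4 by rewrite mulr_ge0.
have d_cvg0 : d @ \oo --> 0 by exact: cvg_series_cvg_0.
(* The first term bounds the contribution of [C k.+1 - C k], the second that of [T k - D], after
   division by the length of the step. *)
have bound_cvg0 : (fun k => K4 * (K2 * (2 * q k)) + K4 * (m * d k)) @ \oo --> 0.
  rewrite -[X in _ --> X]addr0; apply: cvgD.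
    rewrite -[X in _ --> X](mulr0 K4); apply: cvgMl_tmp.
    rewrite -[X in _ --> X](mulr0 K2); apply: cvgMl_tmp.
    by rewrite -[X in _ --> X](mulr0 2); apply: cvgMl_tmp.
  rewrite -[X in _ --> X](mulr0 K4); apply: cvgMl_tmp.
  by rewrite -[X in _ --> X](mulr0 m); apply: cvgMl_tmp.
apply: (squeeze_cvgr _ (cvg_cst 0) bound_cvg0); exists N => // k /= Nk.
have sk := vnorm2_gt0 (hs k).
rewrite divr_ge0 ?l2norm_ge0 ?vnorm2_ge0//= ler_pdivrMr//.
apply: le_trans (frob_tfix_triangle p _ _ (T k) _) _.
rewrite (secant_min_tfix (hC k)) mulrDl; apply: lerD.
- apply: le_trans (frob_tfix_le _ _ _) _.
  rewrite -/K4 mulrAC ler_wpM2r ?vnorm2_ge0// ler_wpM2l//.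
  apply: le_trans (frob_le_star _) _; rewrite ler_wpM2l//.
  apply: le_trans (b_le k _ Nk) _; rewrite ler_wpM2r//.
  by have := epsN k Nk; rewrite /=; lra.
- apply: le_trans (frob_tfix_le _ _ _) _.
  by rewrite -/K4 mulrAC ler_wpM2r ?vnorm2_ge0// ler_wpM2l.
Qed.
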